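(* Let $(X,f)$ be a dynamical system (with nonempty compact Hausdorff phase space). The map $\Lambda_0:(\mathrm{Ob}\,\mathfrak B_0'(X,f),\preceq)\to(\Sigma(X,f),\le)$, $\Lambda_0(h,(A,g))=\Phi(\mathcal P(A,g))$, preserves the order relation. The pre-image $\Lambda_0^{-1}(\Phi(\mathcal P(X,f)))$ of the greatest element of $(\Sigma(X,f),\le)$ coincides with the class of all maximal elements of $(\mathrm{Ob}\,\mathfrak B_0'(X,f),\preceq)$.
   Context: Here $\mathbb N=\{1,2,\dots\}$. A dynamical system is a pair $(X,f)$ with $X$ a nonempty compact Hausdorff space and $f:X\to X$ a homeomorphism. A morphism $h:(X,f)\to(Y,g)$ is a continuous map $h:X\to Y$ with $h\circ f=g\circ h$; the category so obtained is $\mathcal K_0$. Topologically conjugate means isomorphic in $\mathcal K_0$. A periodic partition of $(X,f)$ of length $m\in\mathbb N$ is a family $\{W_i\}_{i=0}^{m-1}$ of pairwise disjoint open-closed subsets of $X$ with union $X$, such that $f(W_{i-1})=W_i$ for $i=1,\dots,m-1$ and $f(W_{m-1})=W_0$. $\mathcal P(X,f)\subseteq\mathbb N$ is the set of lengths of all periodic partitions of $(X,f)$. An ultranatural number is a family $N=(N_p)_p$ indexed by primes $p$ with $N_p\in\{0,1,2,\dots\}\cup\{\infty\}$; the set $\Sigma$ of these is ordered by $M\le N$ iff $M_p\le N_p$ for all $p$. For nonempty $S\subseteq\mathbb N$, $\Phi(S)\in\Sigma$ is defined by $\Phi(S)_p=\sup\{k\ge 0: p^k \text{ divides some } a\in S\}$.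 $\Sigma(X,f)=\{N\in\Sigma: N\le\Phi(\mathcal P(X,f))\}$. An odometer: given a sequence $\{n_i\}_{i\in\mathbb N}$ of positive integers with $n_i\mid n_{i+1}$ (bounded sequences allowed), $A=\varprojlim \mathbb Z/n_i\mathbb Z$ (inverse limit of discrete cyclic groups along the maps $1\mapsto 1$, with the inverse limit topology) and $g(\vec a)=\vec a+\vec e$, $\vec e=(1,1,\dots)$; $(A,g)$ is the odometer constructed on $\{n_i\}$. $\mathcal A$ is the full subcategory of $\mathcal K_0$ whose objects are the dynamical systems topologically conjugate to odometers; $\mathcal A(X,f)$ is the full subcategory of $\mathcal A$ of objects $(A,g)$ with $\Phi(\mathcal P(A,g))\le\Phi(\mathcal P(X,f))$. A skeleton of a category is a full subcategory containing exactly one representative of each isomorphism class of objects. $\mathcal A_0(X,f)$ is a fixed skeleton of $\mathcal A(X,f)$. The category $\mathfrak B(X,f)$: objects are pairs $(h,(A,g))$ with $(A,g)$ an object of $\mathcal A(X,f)$ and $h:(X,f)\to(A,g)$ a morphism; morphisms from $(h_1,(A_1,g_1))$ to $(h_2,(A_2,g_2))$ are the (triples given by) morphisms $\pi:(A_1,g_1)\to(A_2,g_2)$ with $h_2=\pi\circ h_1$. $\mathfrak B'(X,f)$ is the full subcategory of $\mathfrak B(X,f)$ of objects $(h,(A,g))$ with $(A,g)\in\mathrm{Ob}\,\mathcal A_0(X,f)$, and $\mathfrak B_0'(X,f)$ is a fixed skeleton of $\mathfrak B'(X,f)$. For objects of $\mathfrak B_0'(X,f)$, $(h_1,(A_1,g_1))\preceq(h_2,(A_2,g_2))$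 means that there exists a morphism in $\mathfrak B(X,f)$ from $(h_2,(A_2,g_2))$ to $(h_1,(A_1,g_1))$; this is a partial order. *)

(* Defs.v *)
From HB Require Import structures.
From mathcomp Require Import all_boot all_order all_algebra.
From mathcomp Require Import all_classical all_reals topology.

Set Implicit Arguments.
Unset Strict Implicit.
Unset Printing Implicit Defensive.

Import Order.TTheory GRing.Theory.

Local Open Scope classical_set_scope.

(** * Categories *)

Record category := Category {
  obj :> Type;
  hom : obj -> obj -> Type;
  idc : forall x, hom x x;
  compc : forall x y z, hom y z -> hom x y -> hom x z;
  compc1l : forall x y (u : hom x y), compc (idc y) u = u;
  compc1r : forall x y (u : hom x y), compc u (idc x) = u;
  compcA : forall x y z t (w : hom z t) (v : hom y z) (u : hom x y),
    compc w (compc v u) = compc (compc w v) u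
}.
Arguments hom {c} _ _ : rename.
Arguments idc {c} _ : rename.
Arguments compc {c x y z} _ _ : rename.

Definition isomorphic (C : category) (x y : C) : Prop :=
  exists (u : hom x y) (v : hom y x), compc v u = idc x /\ compc u v = idc y.

Definition full_subcategory (C : category) (P : C -> Prop) : category :=
  @Category {x : C | P x} (fun x y => hom (sval x) (sval y))
    (fun x => idc (sval x)) (fun _ _ _ v u => compc v u)
    (fun _ _ u => compc1l u) (fun _ _ u => compc1r u)
    (fun _ _ _ _ w v u => compcA w v u).

(* A full subcategory is given by its class of objects [S]; its members are
   compared with Leibniz equality, i.e. up to identity and not isomorphism. *)
Definition skeleton (C : category) (S : C -> Prop) : Prop :=
  forall x : C, exists! y : C, S y /\ isomorphic x y.

Definition maximal (T : Type) (le : T -> T -> Prop) (x : T) : Prop :=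
  forall y, le x y -> y = x.

(** * Dynamical systems *)

Definition homeomorphism (X Y : topologicalType) (f : X -> Y) : Prop :=
  continuous f /\
  exists g : Y -> X, [/\ continuous g, cancel f g & cancel g f].

Record dynsys := DynSys {
  space :> topologicalType;
  dmap : space -> space;
  space_nonempty : [set: space] !=set0;
  space_compact : compact [set: space];
  space_hausdorff : hausdorff_space space;
  dmap_homeomorphism : homeomorphism dmap
}.

Record dynmor (X Y : dynsys) := DynMor {
  mor :> X -> Y;
  mor_continuous : continuous mor;
  mor_commutes : mor \o @dmap X = @dmap Y \o mor
}.

Lemma dynmorP (X Y : dynsys) (u v : dynmor X Y) : u =1 v -> u = v.
Proof.
case: u v => [u cu eu] [v cv ev] /= /funext uv.
by move: cu eu cv ev; rewrite uv => *; congr DynMor; exact: Prop_irrelevance.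
Qed.

Definition dynmor_id (X : dynsys) : dynmor X X :=
  @DynMor X X id (fun=> cvg_id) erefl.

Lemma dynmor_comp_continuous (X Y Z : dynsys) (v : dynmor Y Z)
  (u : dynmor X Y) : continuous (v \o u).
Proof.
by move=> x; apply: continuous_comp; [exact: mor_continuous|
  exact: mor_continuous].
Qed.

Lemma dynmor_comp_commutes (X Y Z : dynsys) (v : dynmor Y Z)
  (u : dynmor X Y) : (v \o u) \o @dmap X = @dmap Z \o (v \o u).
Proof. by rewrite -compA mor_commutes compA mor_commutes. Qed.

Definition dynmor_comp (X Y Z : dynsys) (v : dynmor Y Z) (u : dynmor X Y) :
    dynmor X Z :=
  DynMor (@dynmor_comp_continuous X Y Z v u) (dynmor_comp_commutes v u).

Lemma dynmor_comp1l (X Y : dynsys) (u : dynmor X Y) :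
  dynmor_comp (dynmor_id Y) u = u.
Proof. exact: dynmorP. Qed.

Lemma dynmor_comp1r (X Y : dynsys) (u : dynmor X Y) :
  dynmor_comp u (dynmor_id X) = u.
Proof. exact: dynmorP. Qed.

Lemma dynmor_compA (X Y Z T : dynsys) (w : dynmor Z T) (v : dynmor Y Z)
    (u : dynmor X Y) :
  dynmor_comp w (dynmor_comp v u) = dynmor_comp (dynmor_comp w v) u.
Proof. exact: dynmorP. Qed.

Definition catK0 : category :=
  Category dynmor_comp1l dynmor_comp1r dynmor_compA.

(** * Periodic partitions *)

(* Only the values [W 0, ..., W m.-1] are relevant. *)
Definition periodic_partition (X : dynsys) (m : nat) (W : nat -> set X) : Prop :=
  [/\ forall i, (i < m)%N -> clopen (W i),
      trivIset `I_m W,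
      \bigcup_(i in `I_m) W i = [set: X],
      forall i, (0 < i < m)%N -> @dmap X @` W i.-1 = W i
    & @dmap X @` W m.-1 = W 0%N].

Definition periods (X : dynsys) : set nat :=
  [set m | (0 < m)%N /\ exists W, periodic_partition (X := X) m W].

(** * Ultranatural numbers *)

(* Natural numbers extended with infinity, represented by [None]. *)
Definition enat := option nat.

Definition enat_le (x y : enat) : bool :=
  match x, y with
  | _, None => true
  | None, Some _ => false
  | Some m, Some n => (m <= n)%N
  end.

HB.instance Definition _ := Choice.copy enat (option nat).

Lemma enat_le_refl : reflexive enat_le. Proof. by case=> [n|] /=. Qed.

Lemma enat_le_anti : antisymmetric enat_le.
Proof. by case=> [m|] [n|] //= /anti_leq ->. Qed.

Lemma enat_le_trans : transitive enat_le.
Proof. by case=> [m|] [n|] [p|] //=; exact: leq_trans. Qed.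

Fact enat_display : Order.disp_t. Proof. exact: Order.Disp tt tt. Qed.

HB.instance Definition _ := Order.Le_isPOrder.Build enat_display enat
  enat_le_refl enat_le_anti enat_le_trans.

Definition enat_sup (A : set enat) : enat := supremum (Some 0%N : enat) A.

Lemma enat_sup_isLub (A : set enat) : isLub A (enat_sup A).
Proof.
suff [s As] : exists s, supremums A s.
  rewrite /enat_sup /supremum; case: ifPn => [/eqP->|_].
    by split => // -[b|].
  by case: xgetP => [x _ //|/(_ s)].
have [[n An]|/forallNP noub] := pselect (exists n : nat, ubound A (Some n)).
  have ex : exists n : nat, `[< ubound A (Some n) >] by exists n; exact/asboolP.
  case: (ex_minnP ex) => m /asboolP ubm minm; exists (Some m); split => //.
  by move=> [b|] // ubb; apply: minm; exact/asboolP.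
exists None; split; first by move=> [x|].
by move=> [b|] // /(noub b).
Qed.

Definition ultranatural := {p : nat | prime p} -> enat.

Definition ultra_le (M N : ultranatural) : Prop := forall p, (M p <= N p)%O.

Definition Phi (S : set nat) : ultranatural := fun p =>
  enat_sup [set Some k | k in [set k | exists2 a, S a & (sval p ^ k %| a)%N]].

Definition Sigma (X : dynsys) := {N : ultranatural | ultra_le N (Phi (periods X))}.

Definition Sigma_le (X : dynsys) (M N : Sigma X) : Prop :=
  ultra_le (sval M) (sval N).

Lemma ultra_lexx (N : ultranatural) : ultra_le N N.
Proof. by move=> p; exact: lexx. Qed.

Definition Sigma_max (X : dynsys) : Sigma X :=
  exist (ultra_le^~ (Phi (periods X))) (Phi (periods X)) (ultra_lexx _).

(** * Odometers *)

Record odoseq := OdoSeq {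
  oseq :> nat -> nat;
  oseq_gt0 : forall i, (0 < oseq i)%N;
  oseq_dvd : forall i, (oseq i %| oseq i.+1)%N
}.

(* The group Z/mZ for m > 0; the detour through the predecessor provides the
   zmodType structure and makes m = 1 the trivial group, unlike ['Z_1]. *)
Definition Zmod (m : nat) : Type := 'I_(m.-1.+1).
HB.instance Definition _ m := GRing.Zmodule.copy (Zmod m) 'I_(m.-1.+1).

Definition Zmod1 (m : nat) : Zmod m := inZp 1.

(* When k divides m > 0, the group morphism Z/mZ -> Z/kZ mapping 1 to 1. *)
Definition Zmod_red (m k : nat) (x : Zmod m) : Zmod k := inZp (x : 'I__).

Lemma Zmod_redD (m k : nat) (x y : Zmod m) : (0 < m)%N -> (k %| m)%N ->
  Zmod_red k (x + y)%R = (Zmod_red k x + Zmod_red k y)%R.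
Proof.
move=> m0 km; have k0 : (0 < k)%N by exact: dvdn_gt0 km.
apply: val_inj => /=.
by rewrite modn_dvdm ?modnDm // !prednK.
Qed.

Lemma Zmod_redN (m k : nat) (x : Zmod m) : (0 < m)%N -> (k %| m)%N ->
  Zmod_red k (- x)%R = (- Zmod_red k x)%R.
Proof.
move=> m0 km; apply: (addIr (Zmod_red k x)).
by rewrite -Zmod_redD // !addNr; apply: val_inj; rewrite /= mod0n.
Qed.

Lemma Zmod_red1 (m k : nat) : (0 < m)%N -> (k %| m)%N ->
  Zmod_red k (Zmod1 m) = Zmod1 k.
Proof.
move=> m0 km; have k0 : (0 < k)%N by exact: dvdn_gt0 km.
by apply: val_inj => /=; rewrite modn_dvdm // !prednK.
Qed.

Definition odo_prod (n : nat -> nat) : topologicalType :=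
  prod_topology (fun i : nat => discrete_topology (Zmod (n i))).

(* The inverse limit; as a type it has the subspace topology. *)
Definition odo_set (n : nat -> nat) : set (odo_prod n) :=
  [set a | forall i, Zmod_red (n i) (a i.+1 : Zmod (n i.+1)) = a i].
Arguments odo_set n : clear implicits.

Definition odo_one (n : nat -> nat) : odo_prod n := fun i => Zmod1 (n i).

Definition odo_opp (n : nat -> nat) (a : odo_prod n) : odo_prod n :=
  fun i => (- (a i : Zmod (n i)))%R.

Definition odo_add (n : nat -> nat) (a b : odo_prod n) : odo_prod n :=
  fun i => ((a i : Zmod (n i)) + (b i : Zmod (n i)))%R.

Section Odometer.
Variable n : odoseq.

Lemma odo_oneP : odo_set n (odo_one n).
Proof. by move=> i; rewrite Zmod_red1 ?oseq_gt0 ?oseq_dvd. Qed.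

Lemma odo_oppP (a : odo_prod n) : odo_set n a -> odo_set n (odo_opp a).
Proof. by move=> ha i; rewrite Zmod_redN ?oseq_gt0 ?oseq_dvd ?ha. Qed.

Lemma odo_addP (a b : odo_prod n) :
  odo_set n a -> odo_set n b -> odo_set n (odo_add a b).
Proof. by move=> ha hb i; rewrite Zmod_redD ?oseq_gt0 ?oseq_dvd ?ha ?hb. Qed.

Definition odo_map (a : odo_set n) : odo_set n :=
  exist _ (odo_add (set_val a) (odo_one n))
    (mem_set (odo_addP (set_valP a) odo_oneP)).

Definition odo_inv (a : odo_set n) : odo_set n :=
  exist _ (odo_add (set_val a) (odo_opp (odo_one n)))
    (mem_set (odo_addP (set_valP a) (odo_oppP odo_oneP))).

Lemma odo_mapK : cancel odo_map odo_inv.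
Proof.
move=> a; apply: val_inj; apply: functional_extensionality_dep => i.
exact: addrK.
Qed.

Lemma odo_invK : cancel odo_inv odo_map.
Proof.
move=> a; apply: val_inj; apply: functional_extensionality_dep => i.
exact: subrK.
Qed.

Lemma odo_coord_continuous i :
  continuous ((fun a => set_val a i) : odo_set n -> discrete_topology (Zmod (n i))).
Proof.
move=> a; apply: (@continuous_comp _ (odo_prod n) _ set_val (proj i)).
  exact: initial_continuous.
exact: (@proj_continuous _ (fun i => discrete_topology (Zmod (n i)))).
Qed.

Lemma odo_continuous (f : odo_set n -> odo_set n)
    (g : forall i, Zmod (n i) -> Zmod (n i)) :
  (forall a i, set_val (f a) i = g i (set_val a i)) -> continuous f.
Proof.
move=> fg; apply: continuous_comp_initial => a.
have FF : Filter ((set_val \o f) b @[b --> a]) by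
  exact: (fmap_filter _ (nbhs_filter a)).
apply/cvg_sup => i U [_ [[V _ <-]] /= Va VU].
have oW : open (g i @^-1` V : set (discrete_topology (Zmod (n i)))).
  exact: discrete_open.
have nV : nbhs a ((fun b => set_val b i) @^-1` (g i @^-1` V)).
  apply: odo_coord_continuous; apply: open_nbhs_nbhs; split => //=.
  by rewrite -fg.
by apply: filterS nV => b /= gV; apply: VU; rewrite /= fg.
Qed.

Lemma odo_nonempty : [set: odo_set n] !=set0.
Proof. by exists (exist _ (odo_one n) (mem_set odo_oneP)). Qed.

Lemma odo_prod_compact : compact [set: odo_prod n].
Proof.
have cT i : compact [set: discrete_topology (Zmod (n i))].
  exact/finite_compact/(@finite_finset 'I_(n i).-1.+1).
by have := tychonoff cT; congr compact; rewrite eqEsubset; split.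
Qed.

Lemma odo_set_closed : closed (odo_set n).
Proof.
have -> : odo_set n = \bigcap_i
    [set a | Zmod_red (n i) (a i.+1 : Zmod (n i.+1)) = a i].
  by rewrite eqEsubset; split => a h i; [move=> _; exact: h|exact: (h i I)].
apply: closed_bigI => i _; rewrite -openC openE => a /= ha.
pose pr j := @proj_continuous _ (fun i => discrete_topology (Zmod (n i))) j a.
have nb j : nbhs a (proj j @^-1` [set a j] : set (odo_prod n)).
  by apply: pr; exact: (@discrete_set1 (discrete_topology (Zmod (n j)))).
near=> b => /=; have -> : b i = a i by near: b; exact: nb.
by have -> : b i.+1 = a i.+1 by near: b; exact: nb.
Unshelve. all: by end_near. Qed.

Lemma odo_compact : compact [set: odo_set n].
Proof.
have cA : compact (odo_set n).
  exact: subclosed_compact odo_set_closed odo_prod_compact _.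
move=> F PF _; have [|p [Ap clp]] := cA (set_val @ F).
  apply: (@filterS _ F _ setT); last exact: filterT.
  by move=> a _; exact: (set_valP a).
exists (exist _ p (mem_set Ap)); split => // U V FU [_ [[W oW <-] /= Wp WV]].
have [||_ [[a Ua <-] Wa]] := clp (set_val @` U) W.
- by apply: (@filterS _ F _ U) => // a Ua; exists a.
- exact: open_nbhs_nbhs.
- by exists a; split => //; exact: WV.
Qed.

Lemma odo_hausdorff : hausdorff_space (odo_set n).
Proof.
move=> a b ab; apply: val_inj; apply: functional_extensionality_dep => i.
apply: (@discrete_hausdorff (discrete_topology (Zmod (n i)))) => U V aU bV.
have [c [cU cV]] := ab _ _ (odo_coord_continuous aU) (odo_coord_continuous bV).
by exists (set_val c i).
Qed.

Lemma odo_homeomorphism : homeomorphism odo_map.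
Proof.
split; first exact: (@odo_continuous _ (fun i x => x + Zmod1 (n i))%R).
exists odo_inv; split; [|exact: odo_mapK|exact: odo_invK].
exact: (@odo_continuous _ (fun i x => x - Zmod1 (n i))%R).
Qed.

Definition odometer : dynsys :=
  DynSys odo_nonempty odo_compact odo_hausdorff odo_homeomorphism.

End Odometer.

(** * The categories attached to a dynamical system *)

Definition catA : category :=
  full_subcategory (fun A : catK0 => exists n : odoseq, isomorphic A (odometer n : catK0)).

Definition catAX (X : dynsys) : category :=
  full_subcategory
    (fun A : catA => ultra_le (Phi (periods (sval A))) (Phi (periods X))).

Record objB (X : dynsys) := ObjB {
  objB_sys : catAX X;
  objB_mor : dynmor X (sval (sval objB_sys))
}.

(* The source and target that make up the rest of the triple are recorded in the
   type of the morphism. *)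
Definition homB (X : dynsys) (o1 o2 : objB X) :=
  {u : dynmor (sval (sval (objB_sys o1))) (sval (sval (objB_sys o2))) |
    objB_mor o2 = dynmor_comp u (objB_mor o1)}.

Section CatB.
Variable X : dynsys.

Lemma homB_idP (o : objB X) : objB_mor o = dynmor_comp (dynmor_id _) (objB_mor o).
Proof. exact: dynmorP. Qed.

Lemma homB_compP (o1 o2 o3 : objB X) (v : homB o2 o3) (u : homB o1 o2) :
  objB_mor o3 = dynmor_comp (dynmor_comp (sval v) (sval u)) (objB_mor o1).
Proof. by case: v u => [v ev] [u eu] /=; rewrite ev eu; exact: dynmorP. Qed.

Lemma homBP (o1 o2 : objB X) (u v : homB o1 o2) :
  sval u =1 sval v -> u = v.
Proof. by move=> uv; apply: eq_sig_hprop; [|exact: dynmorP]. Qed.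

Definition homB_id (o : objB X) : homB o o := exist _ _ (homB_idP o).

Definition homB_comp (o1 o2 o3 : objB X) (v : homB o2 o3) (u : homB o1 o2) :
  homB o1 o3 := exist _ _ (homB_compP v u).

Lemma homB_comp1l (o1 o2 : objB X) (u : homB o1 o2) :
  homB_comp (homB_id o2) u = u.
Proof. exact: homBP. Qed.

Lemma homB_comp1r (o1 o2 : objB X) (u : homB o1 o2) :
  homB_comp u (homB_id o1) = u.
Proof. exact: homBP. Qed.

Lemma homB_compA (o1 o2 o3 o4 : objB X) (w : homB o3 o4) (v : homB o2 o3)
    (u : homB o1 o2) :
  homB_comp w (homB_comp v u) = homB_comp (homB_comp w v) u.
Proof. exact: homBP. Qed.

Definition catB : category := Category homB_comp1l homB_comp1r homB_compA.

End CatB.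

Definition catB' (X : dynsys) (A0 : catAX X -> Prop) : category :=
  full_subcategory (fun o : catB X => A0 (objB_sys o)).

(* For [A0] and [B0] skeletons, this is the category B'_0(X, f). *)
Definition catB0' (X : dynsys) (A0 : catAX X -> Prop) (B0 : catB' A0 -> Prop) :
  category := full_subcategory B0.

Definition preceq (X : dynsys) (A0 : catAX X -> Prop) (B0 : catB' A0 -> Prop)
    (o1 o2 : catB0' B0) : Prop :=
  inhabited (hom (sval (sval o2) : catB X) (sval (sval o1))).

Definition Lambda0 (X : dynsys) (A0 : catAX X -> Prop) (B0 : catB' A0 -> Prop)
    (o : catB0' B0) : Sigma X :=
  let A := objB_sys (sval (sval o)) in
  exist _ (Phi (periods (sval (sval A)))) (svalP A).

(* Main.v *)
Require Import Defs.
From mathcomp Require Import all_boot.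
From mathcomp Require Import all_order zmodp all_classical topology.

(** A periodic partition of length m is the same thing as a phase modulo m: a
    locally constant map c from X to the natural numbers with
    c (f x) = c x + 1 modulo m ([period_phase], [phase_period]). Phases pull
    back along morphisms, hence so do periods, which gives the monotonicity of
    Lambda_0. A morphism from X to the odometer on n is a coherent sequence of
    phases modulo the n_i ([odometer_mor]).

    Let o = (h, A) be an object with Phi (P A) = Phi (P X), and let u : A' -> A
    be a morphism from another object to o. Then Phi (P A') <= Phi (P A). Every
    orbit of an odometer is dense, so on an odometer two phases of the same
    modulus differ by a constant ([phase_unique]). Each prime power p^k
    dividing a modulus of A' is the modulus of a phase of A; pulled back to A',
    this phase agrees up to a constant with the coordinate of A' modulo p^k.
    So u determines all coordinates modulo prime powers, and by the Chinese
    remainder theorem u is injective ([odometer_mor_inj]). It is onto by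
    density, hence an isomorphism by compactness ([catA_iso]), and in a skeleton
    isomorphic objects are equal: o is maximal.

    Conversely let o = (h, A) with A the odometer on n, and suppose that
    Phi (P A) < Phi (P X). For some prime p there is a k such that p^k is the
    largest power of p dividing some n_i, while p^(k+1) divides a period of X.
    A phase of X modulo p^(k+1) can be corrected by an invariant function so as
    to agree with h modulo p^k ([phase_lift]). Gluing it with h by the Chinese
    remainder theorem factors h through an odometer that has the period p^(k+1)
    ([odometer_refinement]). Its representative in the skeletons
    ([catB0'_representative]) lies above o and differs from o, so o is not
    maximal. *)

Set Implicit Arguments.
Unset Strict Implicit.
Unset Printing Implicit Defensive.

Local Open Scope classical_set_scope.

(** * Phases and periodic partitions *)

(** The values are natural numbers rather than classes modulo [m]: this spares the
    dependent types Z/m when moduli vary. *)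
Definition phase (X : dynsys) (m : nat) (c : X -> nat) : Prop :=
  (forall x, \forall y \near x, c y = c x) /\
  (forall x, c (dmap x) = (c x).+1 %[mod m]).

Lemma modn_weaken (d m a b : nat) :
  (d %| m)%N -> a = b %[mod m] -> a = b %[mod d].
Proof. by move=> dm /(congr1 (modn^~ d)); rewrite !modn_dvdm. Qed.

Lemma modn_succ_inj (m a b : nat) : a.+1 = b.+1 %[mod m] -> a = b %[mod m].
Proof. by move=> /eqP; rewrite -(addn1 a) -(addn1 b) eqn_modDr => /eqP. Qed.

(** The sets of the partition are the level sets of [c] modulo [m]; bijectivity of
    the dynamics turns the congruence into an equality of images. *)
Lemma phase_period (X : dynsys) (m : nat) (c : X -> nat) :
  (0 < m)%N -> phase m c -> periods X m.
Proof.
move=> m0 [cloc cstep]; split => //.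
have [_ [g [_ fK gK]]] := dmap_homeomorphism X.
have level_open (P : nat -> Prop) : open [set x | P (c x)].
  rewrite openE => x /= Px; near=> y => /=.
  by have -> : c y = c x by near: y; exact: cloc.
have shift i : (i < m)%N ->
    @dmap X @` [set x | c x %% m = i] = [set x | c x %% m = i.+1 %% m].
  move=> im; rewrite eqEsubset; split => [_ [x /= ci <-]|y /= ci].
    by rewrite cstep -addn1 -modnDml ci addn1.
  exists (g y); last exact: gK.
  have /modn_succ_inj : (c (g y)).+1 = i.+1 %[mod m] by rewrite -cstep gK.
  by rewrite (modn_small im).
exists (fun i => [set x | c x %% m = i]); split.
- move=> i _; split; first exact: level_open (fun k => k %% m = i).
  rewrite -openC; exact: level_open (fun k => ~ k %% m = i).
- by move=> i j _ _ [x [/= <- <-]].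
- rewrite eqEsubset; split => // x _; exists (c x %% m) => //=.
  exact: ltn_pmod.
- move=> [//|i] /= im; rewrite shift ?(ltnW im) //.
  by rewrite (modn_small im).
- by rewrite shift ?prednK // modnn.
Unshelve. all: by end_near. Qed.

Lemma period_phase (X : dynsys) (m : nat) :
  periods X m -> exists c : X -> nat, phase m c.
Proof.
move=> [m0 [W [Wco Wtriv Wcov Wstep Wlast]]].
have /choice [c cP] : forall x : X, exists i, (i < m)%N /\ W i x.
  by move=> x; have : [set: X] x by []; rewrite -Wcov => -[i]; exists i.
have cE i x : (i < m)%N -> W i x -> c x = i.
  by move=> im Wi; have [cm Wc] := cP x; apply: Wtriv => //; exists x.
exists c; split => x; have [cm Wc] := cP x.
  have := open_nbhs_nbhs (conj (Wco _ cm).1 Wc).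
  by apply: filterS => y /(cE _ _ cm).
have [cm'|] := ltnP (c x).+1 m.
  by rewrite (cE (c x).+1) // -Wstep //=; exists x.
move=> cm'; have Em : (c x).+1 = m by apply/eqP; rewrite eqn_leq cm cm'.
rewrite Em (cE 0) ?mod0n ?modnn // -Wlast -{1}Em; by exists x.
Qed.

Lemma phase_pullback (X Y : dynsys) (u : dynmor X Y) m (c : Y -> nat) :
  phase m c -> phase m (c \o u).
Proof.
move=> [cloc cstep]; split => x /=; first exact: (mor_continuous (cloc (u x))).
by rewrite -cstep; congr (c _ %% m); exact: (congr1 (@^~ x) (mor_commutes u)).
Qed.

Lemma periods_pullback (X Y : dynsys) (u : dynmor X Y) :
  periods Y `<=` periods X.
Proof.
move=> m Pm; have [c /(phase_pullback u)] := period_phase Pm.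
by apply: phase_period; case: Pm.
Qed.

Lemma phase_dvd (X : dynsys) d m (c : X -> nat) :
  (d %| m)%N -> phase m c -> phase d c.
Proof. by move=> dm [cl cs]; split => // x; apply: modn_weaken (cs x). Qed.

Lemma phase_iter (X : dynsys) m (c : X -> nat) j x :
  phase m c -> c (iter j (@dmap X) x) = c x + j %[mod m].
Proof.
move=> [_ cs]; elim: j => [|j IH]; first by rewrite addn0.
by rewrite iterS cs -addn1 -modnDml IH modnDml addn1 addnS.
Qed.

(** Modulo [q] the difference between [u] and [c] is invariant, since
    both increase by 1; adding this invariant function to [c] leaves it a phase
    modulo [Q] and makes it agree with [u]. *)
Lemma phase_lift (X : dynsys) q Q (u c : X -> nat) :
  (0 < q)%N -> (q %| Q)%N -> phase q u -> phase Q c ->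
  exists2 c' : X -> nat, phase Q c' & forall x, c' x = u x %[mod q].
Proof.
move=> q0 qQ [ul us] cph; have [cl cs] := cph; have [_ cs'] := phase_dvd qQ cph.
(* [q.-1] stands for -1, so that [d] is u - c modulo [q]. *)
pose d x := (u x + q.-1 * c x) %% q.
have dinv x : d (dmap x) = d x.
  have E k : (u x).+1 + k * (c x).+1 = u x + k * c x + k.+1.
    by rewrite mulnS addSn [k + _]addnC addnA addnS.
  rewrite /d -modnDm -modnMmr us cs' modnMmr modnDm E prednK //.
  by rewrite modnDr.
exists (fun x => c x + d x).
  split => x.
    near=> y; have -> : c y = c x by near: y; exact: cl.
    congr (_ + _); rewrite /d; congr ((_ + _ * _) %% _); near: y.
      exact: ul.
    exact: cl.
  by rewrite dinv -modnDml cs modnDml addSn.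
move=> x; rewrite /d modnDmr addnCA -{1}[c x]mul1n -mulnDl add1n prednK //.
by rewrite mulnC -modnDmr modnMl addn0.
Unshelve. all: by end_near. Qed.

(** * The map Phi *)


(** A supremum of natural numbers that is at least [k] has a term at least [k].
    Nonemptiness matters for [k = 0] only: the supremum of the empty set
    is 0. *)
Lemma le_Phi (S : set nat) (p : {p | prime p}) k : S !=set0 ->
  ((Some k : enat) <= Phi S p)%O <-> exists2 a, S a & (sval p ^ k %| a)%N.
Proof.
move=> [a0 Sa0]; rewrite /Phi; set B := [set Some _ | _ in _].
have [ub lub] := enat_sup_isLub B; split; last by move=> Sk; apply: ub; exists k.
case: k => [|k] kle; first by exists a0.
apply: contrapT => nk.
have /lub : ubound (B : set enat) (Some k : enat).
  move=> _ [j [a Sa pa] <-]; change (j <= k)%N; rewrite leqNgt; apply/negP => kj.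
  by apply: nk; exists a => //; apply: dvdn_trans pa; exact: dvdn_exp2l.
move=> /(Order.POrderTheory.le_trans kle); change (~ (k < k)%N); by rewrite ltnn.
Qed.

Lemma Phi_le (S T : set nat) : T !=set0 ->
  ultra_le (Phi S) (Phi T) <->
  forall (p : {p | prime p}) k a, S a -> (sval p ^ k %| a)%N ->
    exists2 b, T b & (sval p ^ k %| b)%N.
Proof.
move=> T0; split => [le p k a Sa pa|h p].
  apply/le_Phi => //; apply: Order.POrderTheory.le_trans (le p).
  by apply/le_Phi; [exists a|exists a].
apply: (enat_sup_isLub _).2 => _ [k [a Sa pa] <-].
by apply/le_Phi => //; exact: h pa.
Qed.

Lemma periods1 (X : dynsys) : periods X 1.
Proof.
apply: (@phase_period _ _ (fun=> 0)) => //; split => x; last by rewrite !modn1.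
exact: nearW.
Qed.

Lemma periods_nonempty (X : dynsys) : periods X !=set0.
Proof. by exists 1; exact: periods1. Qed.

Lemma Phi_pullback (X Y : dynsys) (u : dynmor X Y) :
  ultra_le (Phi (periods Y)) (Phi (periods X)).
Proof.
apply/(Phi_le _ (periods_nonempty X)) => p k a /(periods_pullback u) Xa pa.
by exists a.
Qed.

(** * Coordinates and topology of odometers *)

Definition coord (n : odoseq) i (a : odometer n) : nat := val (set_val a i).

Lemma coordS (n : odoseq) i (a : odometer n) :
  coord i.+1 a = coord i a %[mod n i].
Proof.
have E m : m = (n i).-1.+1 -> coord i.+1 a %% m = coord i a.
  by move=> ->; exact: (congr1 val (set_valP a i)).
by rewrite -[in RHS](E (n i)) ?modn_mod // prednK ?oseq_gt0.
Qed.

Lemma coord_small (n : odoseq) i (a : odometer n) :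
  coord i a %% n i = coord i a.
Proof.
rewrite modn_small // -[X in _ < X](prednK (oseq_gt0 n i)); exact: ltn_ord.
Qed.

Lemma oseq_dvd_le (n : odoseq) i j : i <= j -> n i %| n j.
Proof.
move=> /subnK <-; elim: (j - i) => [//|k IH].
by rewrite addSn (dvdn_trans IH) ?oseq_dvd.
Qed.

Lemma chain_mod (n : odoseq) (c : nat -> nat) :
  (forall i, c i.+1 = c i %[mod n i]) ->
  forall i j, i <= j -> c j = c i %[mod n i].
Proof.
move=> cS i j /subnK <-; elim: (j - i) => [//|k IH].
rewrite addSn -IH; apply: modn_weaken (cS (k + i)).
exact/oseq_dvd_le/leq_addl.
Qed.

Lemma coord_le (n : odoseq) i j (a b : odometer n) :
  i <= j -> coord j b = coord j a -> coord i b = coord i a.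
Proof.
move=> ij E; rewrite -coord_small -[RHS]coord_small.
rewrite -(chain_mod (c := fun k => coord k b) _ ij); last by move=> k; exact: coordS.
rewrite E (chain_mod (c := fun k => coord k a) _ ij) // => k; exact: coordS.
Qed.

Lemma coord_inj (n : odoseq) (a b : odometer n) :
  (forall i, coord i a = coord i b %[mod n i]) -> a = b.
Proof.
move=> ab; apply: val_inj; apply: functional_extensionality_dep => i.
by apply: val_inj; have := ab i; rewrite !coord_small.
Qed.

Lemma coord_phase (n : odoseq) i : @phase (odometer n) (n i) (coord i).
Proof.
split => a.
  have : nbhs (set_val a i : discrete_topology (Zmod (n i))) [set set_val a i].
    exact: (@discrete_set1 (discrete_topology (Zmod (n i)))).
  move=> /(@odo_coord_continuous n i a) E; near=> b.
  have Eb : set_val b i = set_val a i by near: b; exact: E.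
  exact: (congr1 val Eb).
have E m : m = (n i).-1.+1 -> coord i (dmap a) = (coord i a + 1 %% m) %% m.
  by move=> ->.
by rewrite (E (n i)) ?prednK ?oseq_gt0 // modn_mod modnDmr addn1.
Unshelve. all: by end_near. Qed.

(** Convergence in an odometer is convergence of each coordinate, the topology
    being induced by a product of discrete spaces. *)
Lemma odometer_cvg (n : odoseq) (F : set_system (odometer n)) (a : odometer n) :
  Filter F -> (forall i, F [set b | coord i b = coord i a]) -> F --> a.
Proof.
move=> FF Fa.
have FW : (set_val @ F) --> (set_val a : odo_prod n).
  apply/cvg_sup => i V [_ [[V' _ <-]] /= V'a V'V].
  have sub : [set b : odometer n | coord i b = coord i a] `<=` set_val @^-1` V.
    move=> b /= ba; apply: V'V => /=.
    by rewrite /proj /=; have -> : set_val b i = set_val a i by exact: val_inj.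
  exact: filterS sub (Fa i).
move=> U [_ [[W oW <-]] /= Wa WU]; apply: filterS WU _.
by apply: FW; exact: open_nbhs_nbhs.
Qed.

(** Cylinders on a single coordinate form a basis of neighbourhoods, because
    each coordinate determines the previous ones. This is [odometer_cvg] applied
    to the filter that these cylinders generate. *)
Lemma odometer_nbhs (n : odoseq) (a : odometer n) (U : set (odometer n)) :
  nbhs a U -> exists i, forall b, coord i b = coord i a -> U b.
Proof.
pose F : set_system (odometer n) :=
  [set V | exists i, [set b | coord i b = coord i a] `<=` V].
have FF : Filter F.
  split.
  - by exists 0.
  - move=> V W [i iV] [j jW]; exists (maxn i j) => b /= ba; split.
    + by apply: iV; apply: coord_le ba; exact: leq_maxl.
    + by apply: jW; apply: coord_le ba; exact: leq_maxr.
  - by move=> V W VW [i iV]; exists i; apply: subset_trans VW.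
have Fcv : F --> a by apply: odometer_cvg => i; exists i.
by move=> /Fcv [i iU]; exists i.
Qed.

(** Density of all forward orbits, which for compact systems amounts to the
    absence of proper nonempty closed invariant subsets. *)
Definition minimal (X : dynsys) : Prop :=
  forall (a b : X) U, nbhs b U -> exists j, U (iter j (@dmap X) a).

Lemma odometer_minimal (n : odoseq) : minimal (odometer n).
Proof.
move=> a b U /odometer_nbhs [i iU].
exists (coord i b + (n i - coord i a)); apply: iU.
have le_a : coord i a <= n i.
  by rewrite -coord_small ltnW // ltn_pmod // oseq_gt0.
rewrite -[LHS]coord_small (phase_iter _ _ (coord_phase _ i)).
by rewrite addnCA subnKC // modnDr coord_small.
Qed.

(** In a minimal system two phases differ by a constant: along an orbit both
    increase by the same amount, and the orbit of [a] comes close to [b]. *)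
Lemma phase_unique (X : dynsys) m (c1 c2 : X -> nat) a b :
  minimal X -> phase m c1 -> phase m c2 ->
  c1 a = c1 b %[mod m] -> c2 a = c2 b %[mod m].
Proof.
move=> Xmin ph1 ph2 /eqP E1.
(* Both phases are constant near [b]. *)
have nb : nbhs b [set y | c1 y = c1 b /\ c2 y = c2 b].
  by apply: filterI; [exact: ph1.1|exact: ph2.1].
have [j [j1 j2]] := Xmin a b _ nb.
have /esym/eqP := phase_iter j a ph1; rewrite j1 -(eqP E1).
rewrite -{2}[c1 a]addn0 eqn_modDl => /eqP j0.
by rewrite -j2 (phase_iter j a ph2) -modnDmr j0 mod0n addn0.
Qed.

(** A phase modulo [m] is constant on a cylinder, to which the [n i]-th iterate
    returns; hence [n i] is 0 modulo [m]. *)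
Lemma odometer_periods (n : odoseq) m :
  periods (odometer n) m -> exists i, m %| n i.
Proof.
move=> /period_phase [c ph]; have [a _] := space_nonempty (odometer n).
have [i iU] := odometer_nbhs (ph.1 a); exists i.
have /iU ca : coord i (iter (n i) (@dmap (odometer n)) a) = coord i a.
  rewrite -coord_small (phase_iter _ _ (coord_phase _ i)).
  by rewrite modnDr coord_small.
have /eqP := phase_iter (n i) a ph; rewrite ca.
by rewrite -{1}[c a]addn0 eqn_modDl mod0n eq_sym.
Qed.

Lemma oseq_periods (n : odoseq) i : periods (odometer n) (n i).
Proof. exact: phase_period (oseq_gt0 n i) (coord_phase _ i). Qed.

(** * Morphisms to and from odometers *)

Lemma closed_image (X Y : dynsys) (u : dynmor X Y) (A : set X) :
  closed A -> closed (u @` A).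
Proof.
move=> cA; apply: compact_closed; first exact: space_hausdorff.
apply: continuous_compact; first exact/continuous_subspaceT/mor_continuous.
by apply: subclosed_compact cA (@space_compact X) _.
Qed.

Lemma mor_iter (X Y : dynsys) (u : dynmor X Y) j x :
  u (iter j (@dmap X) x) = iter j (@dmap Y) (u x).
Proof.
elim: j => [//|j IH]; rewrite !iterS -IH.
exact: (congr1 (@^~ _) (mor_commutes u)).
Qed.

(** The image is closed and contains an orbit, which is dense. *)
Lemma mor_onto (X Y : dynsys) (u : dynmor X Y) :
  minimal Y -> forall y, exists x, u x = y.
Proof.
move=> Ymin y; apply: contrapT => ny.
have [x0 _] := space_nonempty X.
have oC : open (~` (u @` setT)).
  by rewrite openC; apply: closed_image; exact: closedT.
have [|j] := Ymin (u x0) y (~` (u @` setT)).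
  by apply: open_nbhs_nbhs; split => // -[x _ xy]; apply: ny; exists x.
by apply; rewrite -mor_iter; exists (iter j (@dmap X) x0).
Qed.

Lemma bijective_iso (X Y : dynsys) (u : dynmor X Y) :
  injective u -> (forall y, exists x, u x = y) ->
  exists2 v : dynmor Y X, cancel u v & cancel v u.
Proof.
move=> uI /choice [v vK].
have uK : cancel u v by move=> x; apply: uI.
have vcont : continuous v.
  apply/continuous_closedP => A cA.
  have -> : v @^-1` A = u @` A.
    rewrite eqEsubset; split => [y /= Ay|_ [x Ax <-] /=].
      by exists (v y).
    by rewrite uK.
  exact: closed_image.
have vcomm : v \o @dmap Y = @dmap X \o v.
  apply/funext => y /=; apply: uI; rewrite vK.
  by rewrite (mor_iter u 1 (v y)) /= vK.
by exists (DynMor vcont vcomm).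
Qed.

Lemma eqn_mod_prime_powers N a b : 0 < N ->
  (forall p, prime p -> a = b %[mod p ^ logn p N]) -> a = b %[mod N].
Proof.
move=> N0; wlog ab : a b / a <= b => [wl|] h.
  by have [/wl|/ltnW/wl] := leqP a b; [exact|
    move=> wl'; apply/esym/wl' => p /h].
apply/esym/eqP; rewrite eqn_mod_dvd //; apply/dvdn_partP => // p.
rewrite mem_primes => /andP[pp _]; rewrite p_part -eqn_mod_dvd //.
by apply/eqP/esym/h.
Qed.

(** For each prime power dividing a modulus of the odometer, [Y] has a phase of that
    modulus. Its pull-back along [u] determines the corresponding coordinate by
    [phase_unique], and [u a = u b] makes it take the same value at [a] and
    [b]. *)
Lemma odometer_mor_inj (n : odoseq) (Y : dynsys) (u : dynmor (odometer n) Y) :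
  ultra_le (Phi (periods (odometer n))) (Phi (periods Y)) -> injective u.
Proof.
move=> /(Phi_le _ (periods_nonempty Y)) le a b uab; apply: coord_inj => i.
apply: eqn_mod_prime_powers => [|p pp]; first exact: oseq_gt0.
have [m Ym pm] := le (exist _ p pp) _ _ (oseq_periods n i) (pfactor_dvdnn p _).
have [c /(phase_dvd pm)/(phase_pullback u) cu] := period_phase Ym.
apply: (phase_unique (@odometer_minimal n) cu); last by rewrite /= uab.
exact: phase_dvd (pfactor_dvdnn p _) (coord_phase _ i).
Qed.

(** The universal property of the inverse limit, read on phases. *)
Lemma odometer_mor (X : dynsys) (n : odoseq) (c : nat -> X -> nat) :
  (forall i, phase (n i) (c i)) ->
  (forall i x, c i.+1 x = c i x %[mod n i]) ->
  exists h : dynmor X (odometer n), forall i x, coord i (h x) = c i x %[mod n i].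
Proof.
move=> ph cS.
pose h0 x : odo_prod n := fun i => inZp (c i x) : Zmod (n i).
have E i m : m = (n i).-1.+1 -> forall x, val (h0 x i) = c i x %% m by move=> ->.
have h0P x : odo_set n (h0 x).
  move=> i; apply: val_inj; rewrite (E i (n i)) ?prednK ?oseq_gt0 //.
  rewrite -cS -(@modn_dvdm (n i.+1)) ?oseq_dvd //.
  rewrite -(E i.+1 (n i.+1)) ?prednK ?oseq_gt0 //.
  have E' m : m = (n i).-1.+1 ->
    val (Zmod_red (n i) (h0 x i.+1 : Zmod _)) = val (h0 x i.+1) %% m by move=> ->.
  by rewrite (E' (n i)) ?prednK ?oseq_gt0.
pose h x : odometer n := exist _ (h0 x) (mem_set (h0P x)).
have hE i x : coord i (h x) = c i x %[mod n i].
  by rewrite coord_small; apply: E; rewrite prednK ?oseq_gt0.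
have hcont : continuous h.
  move=> x; apply: odometer_cvg => i.
  apply: filterS ((ph i).1 x) => y /= cy.
  by rewrite -coord_small hE cy -hE coord_small.
have hcomm : h \o @dmap X = @dmap (odometer n) \o h.
  apply/funext => x /=; apply: coord_inj => i.
  by rewrite (coord_phase _ i).2 hE (ph i).2 -addn1 -modnDml -hE modnDml addn1.
by exists (DynMor hcont hcomm).
Qed.

(** * Refining an odometer by one prime power *)

Lemma nat_jump (P : nat -> Prop) k :
  P 0 -> ~ P k -> exists2 j, j < k & P j /\ ~ P j.+1.
Proof.
elim: k => [//|k IH] P0 nP; have [Pk|nPk] := pselect (P k); first by exists k.
by have [j jk Pj] := IH P0 nPk; exists j => //; exact: ltnW.
Qed.

(** The new moduli are obtained by raising the p-part of each [n i], which divides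
    [p ^ k], to [p ^ k.+1]. A phase of this modulus is glued from the
    prime-to-[p] part of [h] and one phase [t] of modulus [p ^ k.+1] common to all
    indices; the result refines [h] as soon as [t] agrees with [h] modulo
    [p ^ k], the largest power of [p] that [h] sees. *)
Lemma odometer_refinement (X : dynsys) (n : odoseq) (h : dynmor X (odometer n))
    p k i0 m :
  prime p -> p ^ k %| n i0 -> (forall i, ~ p ^ k.+1 %| n i) ->
  periods X m -> p ^ k.+1 %| m ->
  exists (n' : odoseq) (h' : dynmor X (odometer n'))
    (r : dynmor (odometer n') (odometer n)),
    dynmor_comp r h' = h /\ exists i, p ^ k.+1 %| n' i.
Proof.
move=> pp pk nk Xm pm.
pose r i := (n i)`_(p^')%N; pose Q := p ^ k.+1.
have Q0 : 0 < Q by rewrite expn_gt0 prime_gt0.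
have co i : coprime (r i) Q.
  by rewrite coprimeXr // coprime_sym prime_coprime // -p'natE // part_pnat.
have rn i : r i %| n i by exact: dvdn_part.
have gt0 i : 0 < r i * Q by rewrite muln_gt0 part_gt0 Q0.
have dvd i : r i * Q %| r i.+1 * Q.
  by rewrite dvdn_pmul2r // partn_dvd ?oseq_gt0 ?oseq_dvd.
pose n' := OdoSeq gt0 dvd.
have partk i : (n i)`_p %| p ^ k.
  rewrite p_part dvdn_exp2l // leqNgt; apply/negP => lk; apply: (nk i).
  by rewrite pfactor_dvdn ?oseq_gt0.
have nn' i : n i %| n' i.
  rewrite -[n i](partnC p) ?oseq_gt0 // mulnC /= dvdn_mul //.
  by apply: dvdn_trans (partk i) _; rewrite dvdn_exp2l.
pose c i := coord i \o h.
have cph i : phase (n i) (c i) by exact/phase_pullback/coord_phase.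
have cS i x : c i.+1 x = c i x %[mod n i] by exact: coordS.
have [z zph] := period_phase Xm.
have [||||t tph tc] := @phase_lift X (p ^ k) Q (c i0) z.
- by rewrite expn_gt0 prime_gt0.
- by rewrite dvdn_exp2l.
- exact: phase_dvd pk (cph i0).
- exact: phase_dvd pm zph.
pose c' i x := chinese (r i) Q (c i x) (t x).
have c'ph i : phase (n' i) (c' i).
  split => x.
    near=> y; congr chinese; near: y; [exact: (cph i).1|exact: tph.1].
  apply/eqP; rewrite chinese_remainder //; apply/andP; split; apply/eqP.
    rewrite chinese_modl // -[(c' i x).+1]addn1 -modnDml chinese_modl // modnDml addn1.
    exact: (phase_dvd (rn i) (cph i)).2.
  rewrite chinese_modr // -[(c' i x).+1]addn1 -modnDml chinese_modr // modnDml addn1.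
  exact: tph.2.
have rr i : r i %| r i.+1 by rewrite partn_dvd ?oseq_gt0 ?oseq_dvd.
have c'S i x : c' i.+1 x = c' i x %[mod n' i].
  apply/eqP; rewrite chinese_remainder //; apply/andP; split; apply/eqP.
    rewrite chinese_modl //.
    rewrite (modn_weaken (rr i) (chinese_modl (co i.+1) _ _)).
    exact: modn_weaken (rn i) (cS i x).
  by rewrite !chinese_modr.
have c'c i x : c' i x = c i x %[mod n i].
  apply/eqP; have <- := partnC p (oseq_gt0 n i).
  rewrite chinese_remainder ?coprime_partC //; apply/andP; split; apply/eqP.
    have -> : c' i x = t x %[mod (n i)`_p].
      apply: modn_weaken (chinese_modr (co i) _ _).
      by apply: dvdn_trans (partk i) _; rewrite dvdn_exp2l.
    rewrite (modn_weaken (partk i) (tc x)).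
    (* The coherence of [c] relates the indices [i] and [i0], whichever is the
       larger: modulo [n i] in one case, modulo [n i0] in the other. *)
    have [ii|/ltnW ii] := leqP i i0.
      apply: modn_weaken (dvdn_part _ _) _.
      exact: (chain_mod (c := c^~ x) _ ii).
    apply: modn_weaken (partk i) _; apply: modn_weaken pk _; apply: esym.
    exact: (chain_mod (c := c^~ x) _ ii).
  exact: chinese_modl.
have [h' h'E] := odometer_mor c'ph c'S.
have [|i a|ro roE] := @odometer_mor (odometer n') n (fun i => coord i).
- by move=> i; exact: phase_dvd (nn' i) (coord_phase _ i).
- exact: modn_weaken (nn' i) (coordS i a).
exists n', h', ro; split; last by exists 0; rewrite dvdn_mull.
apply: dynmorP => x /=; apply: coord_inj => i.
by rewrite roE (modn_weaken (nn' i) (h'E i x)) c'c.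
Unshelve. all: by end_near. Qed.

(** * Isomorphisms and representatives in the skeletons *)

(** An inequality between the ultranatural numbers, opposite to the one that the
    morphism [u] provides, already forces [u] to be an isomorphism. Both systems
    are replaced by genuine odometers, on which [u] becomes injective and
    onto. *)
Lemma catA_iso (A B : Defs.catA) (u : dynmor (sval A) (sval B)) :
  ultra_le (Phi (periods (sval A))) (Phi (periods (sval B))) ->
  exists v : dynmor (sval B) (sval A),
    dynmor_comp v u = dynmor_id _ /\ dynmor_comp u v = dynmor_id _.
Proof.
have [n [e [e' [e'e ee']]]] := svalP A; have [m [d [d' [d'd dd']]]] := svalP B.
move=> le; pose w := dynmor_comp d (dynmor_comp u e').
have eK : cancel e e' by move=> x; exact: (congr1 (fun k : dynmor _ _ => k x) e'e).
have e'K : cancel e' e by move=> x; exact: (congr1 (fun k : dynmor _ _ => k x) ee').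
have dK : cancel d d' by move=> x; exact: (congr1 (fun k : dynmor _ _ => k x) d'd).
have d'K : cancel d' d by move=> x; exact: (congr1 (fun k : dynmor _ _ => k x) dd').
have wI : injective w.
  apply: odometer_mor_inj => p.
  apply: Order.POrderTheory.le_trans (Phi_pullback d' p).
  exact: Order.POrderTheory.le_trans (Phi_pullback e p) (le p).
have [w' wK w'K] := bijective_iso wI (mor_onto w (@odometer_minimal m)).
exists (dynmor_comp e' (dynmor_comp w' d)); split; apply: dynmorP => x /=.
  by apply: (can_inj eK); rewrite e'K -[RHS]wK /= eK.
by apply: (can_inj dK); have /= -> := w'K (d x).
Qed.

Lemma catB0'_eq (X : dynsys) (A0 : catAX X -> Prop) (B0 : catB' A0 -> Prop)
    (o1 o2 : catB0' B0) :
  skeleton B0 -> isomorphic (sval (sval o1) : catB X) (sval (sval o2)) -> o1 = o2.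
Proof.
move=> hB iso; have [o [_ uo]] := hB (sval o1).
apply: eq_sig_hprop => [o'|]; first exact: Prop_irrelevance.
transitivity o; last first.
  by apply: uo; split; [exact: (svalP o2)|exact: iso].
apply/esym/uo; split; first exact: (svalP o1).
by exists (idc _), (idc _); rewrite !compc1l.
Qed.

(** Two successive replacements are needed, first of the odometer by its
    representative in [A0], then of the resulting object by its representative in
    [B0]. That the odometer belongs to [catAX X] follows from the mere
    existence of [h], by pulling back periods. *)
Lemma catB0'_representative (X : dynsys) (A0 : catAX X -> Prop)
    (B0 : catB' A0 -> Prop) (n : odoseq) (h : dynmor X (odometer n)) :
  skeleton A0 -> skeleton B0 ->
  exists (o : catB0' B0)
    (w : dynmor (sval (sval (objB_sys (sval (sval o))))) (odometer n)),
    dynmor_comp w (objB_mor (sval (sval o))) = h.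
Proof.
move=> hA hB.
have oA : exists m : odoseq, isomorphic (odometer n : catK0) (odometer m : catK0).
  by exists n, (idc _), (idc _); rewrite !compc1l.
pose A : catAX X := exist _ (exist _ (odometer n : catK0) oA) (Phi_pullback h).
have [A1 [[A01 [u [v [vu _]]]] _]] := hA A.
pose b1 : catB' A0 := exist _ (@ObjB X A1 (dynmor_comp u h)) A01.
have [o [[B0o [f [g _]]] _]] := hB b1.
exists (exist _ o B0o), (dynmor_comp v (sval g)).
have := svalP g; rewrite /= => E; rewrite -dynmor_compA -E dynmor_compA.
have -> : dynmor_comp v u = dynmor_id _ by exact: vu.
exact: dynmor_comp1l.
Qed.

(** * Maximal objects *)

Theorem corollary4p1 (X : dynsys)
    (A0 : catAX X -> Prop) (hA0 : skeleton A0)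
    (B0 : catB' A0 -> Prop) (hB0 : skeleton B0) :
  [/\ forall o1 o2 : catB0' B0,
        preceq o1 o2 -> Sigma_le (Lambda0 o1) (Lambda0 o2),
      forall N : Sigma X, Sigma_le N (Sigma_max X)
    & forall o : catB0' B0,
        Lambda0 o = Sigma_max X <-> maximal (@preceq X A0 B0) o].
Proof.
split=> [o1 o2 [u]|N|o]; first exact: Phi_pullback (sval u).
  exact: svalP N.
split=> [E y [f]|omax].
  have {}E := congr1 sval E.
  have [|v [vu uv]] := @catA_iso (sval (objB_sys (sval (sval y))))
    (sval (objB_sys (sval (sval o)))) (sval f).
    move: E; rewrite /= => ->; exact: svalP (objB_sys (sval (sval y))).
  have Ev : objB_mor (sval (sval y)) = dynmor_comp v (objB_mor (sval (sval o))).
    by rewrite (svalP f) dynmor_compA vu dynmor_comp1l.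
  apply: catB0'_eq hB0 _; exists f.
  exists (exist _ v Ev : @hom (catB X) _ _); split; apply: homBP => x /=.
    exact: (congr1 (fun k : dynmor _ _ => k x) vu).
  exact: (congr1 (fun k : dynmor _ _ => k x) uv).
pose AX := objB_sys (sval (sval o)); pose A : dynsys := sval (sval AX).
suff le : ultra_le (Phi (periods X)) (Phi (periods A)).
  apply: eq_sig_hprop => [N|]; first exact: Prop_irrelevance.
  apply: functional_extensionality_dep => p; apply: Order.POrderTheory.le_anti.
  by rewrite le (svalP AX p).
apply/(Phi_le _ (periods_nonempty A)) => -[p pp] k a Xa /= pa.
apply: contrapT => nk.
pose P l := exists2 b, periods A b & p ^ l %| b.
have P0 : P 0 by exists 1 => //; exact: periods1.
have [j jk [[b Ab pb] nj]] := nat_jump P0 (nk : ~ P k).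
(* Here [j] is the exponent of [p] in [Phi (periods A)], and some period of [X] is
   divisible by one more power of [p]. *)
have [n [e [e' [e'e _]]]] := svalP (sval AX).
pose h := objB_mor (sval (sval o)).
have [i0 bi0] := odometer_periods (periods_pullback e' Ab).
have [||||n' [h' [r [rh' [i pi]]]]] :=
    @odometer_refinement X n (dynmor_comp e h) p j i0 a pp.
- exact: dvdn_trans bi0.
- move=> i pi; apply: nj; exists (n i) => //.
  exact: periods_pullback e _ (oseq_periods n i).
- exact: Xa.
- by apply: dvdn_trans pa; exact: dvdn_exp2l.
have [y [w wh']] := catB0'_representative h' hA0 hB0.
have yo : h = dynmor_comp (dynmor_comp e' (dynmor_comp r w)) (objB_mor (sval (sval y))).
  rewrite -2!dynmor_compA wh' rh' dynmor_compA.
  have -> : dynmor_comp e' e = dynmor_id _ by exact: e'e.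
  exact/esym/dynmor_comp1l.
(* By maximality the refinement is [o] itself, although it has a period divisible
   by [p ^ j.+1]. *)
have oy : y = o by apply: omax; exact: inhabits (exist _ _ yo).
apply: nj; exists (n' i) => //; rewrite /A /AX -oy.
exact: periods_pullback w _ (oseq_periods n' i).
Qed.
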